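(* Let $D$ and $E$ be finite sets with $|D|,|E|\ge 2$, let $P:D\times E\to\{0,1\}$ be a binary predicate, and let $0<\varepsilon<1$. (1) If there exist a two-element subset $B\subseteq D$ and a two-element subset $C\subseteq E$ such that $P|_{B\times C}$ is a singleton, then there exists an instance $I$ of $\mathrm{CSP}(P)$ such that every $\varepsilon$-sparsifier of $I$ has $\Omega(n^2)$ constraints, where $n$ is the number of variables of $I$ (i.e., there is a constant $c>0$ such that for infinitely many $n$ there is such an instance on $n$ variables with all $\varepsilon$-sparsifiers having at least $cn^2$ constraints). (2) Otherwise, for every instance $I$ of $\mathrm{CSP}(P)$ on $n$ variables there exists an $\varepsilon$-sparsifier of $I$ with $O(\varepsilon^{-2}n)$ constraints, where the implied constant does not depend on $I$, $n$ or $\varepsilon$.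
   Context: An instance of $\mathrm{CSP}(P)$ for $P:D\times E\to\{0,1\}$ is $I=(V,\Pi,w)$ with $V$ a finite set of $n=|V|$ variables, $\Pi$ a set of constraints $\langle(u,v),P\rangle$ with $u,v\in V$ distinct, and $w:\Pi\to\mathbb{R}_{>0}$. An assignment $A:V\to D\cup E$ is valid if each variable receives a label lying in the intersection of the domains of the constraint positions it occupies: $A(u)\in D$ whenever $u$ is the first variable of some constraint and $A(v)\in E$ whenever $v$ is the second variable of some constraint. $\mathrm{Val}_I(A)=\sum_{\pi=\langle(u,v),P\rangle\in\Pi}w(\pi)P(A(u),A(v))$. An $\varepsilon$-sparsifier of $I$ is $I_\varepsilon=(V,\Pi_\varepsilon,w_\varepsilon)$ with $\Pi_\varepsilon\subseteq\Pi$, $w_\varepsilon:\Pi_\varepsilon\to\mathbb{R}_{>0}$, such that for every valid assignment $A$ of $I$, $(1-\varepsilon)\mathrm{Val}_I(A)\le\mathrm{Val}_{I_\varepsilon}(A)\le(1+\varepsilon)\mathrm{Val}_I(A)$; its number of constraints is $|\Pi_\varepsilon|$. A predicate is a singleton if exactly one tuple is mapped to $1$; $P|_{B\times C}$ is the restriction of $P$ to $B\times C$. *)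

(* Defs.v *)
From mathcomp Require Import all_boot all_order all_algebra.
From mathcomp Require Import reals.
Set Implicit Arguments. Unset Strict Implicit. Unset Printing Implicit Defensive.
Import Order.TTheory GRing.Theory Num.Theory.
Local Open Scope ring_scope.

(* Labels live in a common finite universe U; the domains D, E are subsets of U
   (so that D ∩ E makes sense for variables occupying both positions).
   P : U -> U -> bool; only its restriction to D x E is ever evaluated on
   valid assignments. An instance on n variables is V = 'I_n, a set Pi of
   ordered pairs (u,v) with u <> v (each pair = constraint <(u,v),P>), and a
   weight function w, positive on Pi. *)

Section CSP.
Variables (U : finType) (R : realType).

Definition constraints_ok n (Pi : {set 'I_n * 'I_n}) : Prop :=
  forall e, e \in Pi -> e.1 != e.2.

Definition weights_pos n (Pi : {set 'I_n * 'I_n}) (w : 'I_n * 'I_n -> R) : Prop :=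
  forall e, e \in Pi -> 0 < w e.

Definition is_instance n (Pi : {set 'I_n * 'I_n}) (w : 'I_n * 'I_n -> R) : Prop :=
  constraints_ok Pi /\ weights_pos Pi w.

Definition valid_assignment (D E : {set U}) n (Pi : {set 'I_n * 'I_n})
  (A : 'I_n -> U) : Prop :=
  forall e, e \in Pi -> (A e.1 \in D) /\ (A e.2 \in E).

Definition Val (P : U -> U -> bool) n (Pi : {set 'I_n * 'I_n})
  (w : 'I_n * 'I_n -> R) (A : 'I_n -> U) : R :=
  \sum_(e in Pi) w e * (P (A e.1) (A e.2))%:R.

Definition is_sparsifier (eps : R) (D E : {set U}) (P : U -> U -> bool) n
  (Pi : {set 'I_n * 'I_n}) (w : 'I_n * 'I_n -> R)
  (Pi' : {set 'I_n * 'I_n}) (w' : 'I_n * 'I_n -> R) : Prop :=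
  Pi' \subset Pi /\ weights_pos Pi' w' /\
  forall A, valid_assignment D E Pi A ->
    (1 - eps) * Val P Pi w A <= Val P Pi' w' A /\
    Val P Pi' w' A <= (1 + eps) * Val P Pi w A.

Definition has_singleton_restriction (D E : {set U}) (P : U -> U -> bool) : Prop :=
  exists B C : {set U},
    [/\ B \subset D, #|B| = 2%N, C \subset E, #|C| = 2%N &
        #|[set bc in setX B C | P bc.1 bc.2]| = 1%N].

End CSP.

(* Main.v *)
(* If P is a singleton on B x C, take the complete bipartite instance on
   left and right variables with unit weights. For each constraint there is an
   assignment into B u C satisfying this constraint and no other, so a
   sparsifier must keep all of them.

   Otherwise the complement of P is, as a bipartite graph on D and E, a disjoint
   union of complete bipartite graphs, so P a c amounts to [f a != g c] for
   suitable colourings f and g. The value of an assignment is then a sum over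
   the colours of cut values in the bipartite double cover of the instance, and
   it suffices to approximate the quadratic form [sum_e w_e (a_e . x)^2] by one
   with O(n / eps^2) terms. This is the theorem of Batson, Spielman and
   Srivastava: add rank-one terms greedily while the current matrix A stays
   between l M and u M, with the barrier potentials tr ((u M - A)^-1 M) and
   tr ((A - l M)^-1 M) never increasing although l and u grow. Working relative
   to the target matrix M, instead of normalizing it to the identity, avoids
   square roots and diagonalization. *)
Require Import Defs.
From mathcomp Require Import all_boot all_order all_algebra.
From mathcomp Require Import reals.
From mathcomp Require Import ring lra.
Set Implicit Arguments. Unset Strict Implicit. Unset Printing Implicit Defensive.
Import Order.TTheory GRing.Theory Num.Theory.
Local Open Scope ring_scope.

(** * Positive definite matrices *)

(** The degenerate case [c = 0] is included: a nonnegative affine function of [t] has slope 0. Both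
    Cauchy-Schwarz inequalities below rest on this. *)
Lemma discriminant_le (R : realFieldType) (a b c : R) : 0 <= c ->
  (forall t, 0 <= a + 2 * b * t + c * t ^+ 2) -> b ^+ 2 <= a * c.
Proof.
move=> c0 pos; have [cp|] := ltrP 0 c.
  have cN0 : c != 0 by rewrite gt_eqF.
  have := pos (- b / c).
  have -> : a + 2 * b * (- b / c) + c * (- b / c) ^+ 2 = (a * c - b ^+ 2) / c
    by field.
  by rewrite pmulr_lge0 ?invr_gt0// subr_ge0.
move=> cle; have c_eq : c = 0 by apply/le_anti; rewrite cle c0.
subst c; rewrite mulr0; have [->|bN0] := eqVneq b 0; first by rewrite expr0n.
have := pos (- (a + 1) / (2 * b)).
have -> : a + 2 * b * (- (a + 1) / (2 * b)) + 0 * (- (a + 1) / (2 * b)) ^+ 2 = -1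
  by field.
by rewrite lerNr oppr0 ler10.
Qed.

Section PositiveDefinite.
Variables (R : realFieldType) (r : nat).
Implicit Types (X Y : 'M[R]_r) (x y : 'cV[R]_r) (t : R).

(** The trace turns a 1 x 1 matrix into a scalar and gives access to cyclicity. *)
Definition qform X x : R := \tr (x^T *m X *m x).

Definition posdef X : Prop := X^T = X /\ forall x, x != 0 -> 0 < qform X x.

Lemma qformD X Y x : qform (X + Y) x = qform X x + qform Y x.
Proof. by rewrite /qform mulmxDr mulmxDl mxtraceD. Qed.

Lemma qformZ t X x : qform (t *: X) x = t * qform X x.
Proof. by rewrite /qform -scalemxAr -scalemxAl mxtraceZ. Qed.

Lemma qformB X Y x : qform (X - Y) x = qform X x - qform Y x.
Proof. by rewrite -scaleN1r qformD qformZ mulN1r. Qed.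

Lemma qform0 X : qform X 0 = 0.
Proof. by rewrite /qform mulmx0 mxtrace0. Qed.

Lemma qformE X x : qform X x = \tr (X *m (x *m x^T)).
Proof. by rewrite /qform -mulmxA mxtrace_mulC -mulmxA. Qed.

Lemma qform_congr X Y x : X^T = X -> qform (X *m Y *m X) x = qform Y (X *m x).
Proof. by move=> sX; rewrite /qform trmx_mul sX !mulmxA. Qed.

Lemma qform_rank1 x y : qform (x *m x^T) y = \tr (x^T *m y) ^+ 2.
Proof.
rewrite /qform -mulmxA -mulmxA mulmxA expr2.
have -> : y^T *m x = (x^T *m y)^T by rewrite trmx_mul trmxK.
by rewrite [x^T *m y]mx11_scalar tr_scalar_mx -scalar_mxM !mxtrace_scalar.
Qed.

Lemma posdef_sym X : posdef X -> X^T = X. Proof. by case. Qed.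

Lemma posdef_qform_ge0 X x : posdef X -> 0 <= qform X x.
Proof.
case=> _ pos; have [->|/pos/ltW//] := eqVneq x 0; by rewrite qform0.
Qed.

Lemma posdef_unit X : posdef X -> X \in unitmx.
Proof.
case=> sX pos; rewrite -row_free_unit; apply/inj_row_free => v vX.
apply/eqP; rewrite -[v]trmxK trmx_eq0; apply: contraT => /pos.
by rewrite /qform trmxK vX mul0mx mxtrace0 ltxx.
Qed.

Lemma posdefD X Y : posdef X -> Y^T = Y -> (forall x, 0 <= qform Y x) ->
  posdef (X + Y).
Proof.
case=> sX pX sY pY; split=> [|x xN0]; first by rewrite linearD /= sX sY.
by rewrite qformD ltr_wpDr // pX.
Qed.

Lemma posdefZ t X : 0 < t -> posdef X -> posdef (t *: X).
Proof.
move=> t0 [sX pX]; split=> [|x xN0]; first by rewrite linearZ /= sX.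
by rewrite qformZ mulr_gt0 // pX.
Qed.

Lemma posdef_inv X : posdef X -> posdef (invmx X).
Proof.
move=> pX; have uX := posdef_unit pX; have [sX pos] := pX.
have sI : (invmx X)^T = invmx X by rewrite trmx_inv sX.
split=> // x xN0.
have -> : qform (invmx X) x = qform X (invmx X *m x).
  by rewrite -qform_congr // mulVmx // mul1mx.
apply: pos; apply: contra xN0 => /eqP h.
by rewrite -[x](mulKVmx uX) h mulmx0.
Qed.

(** The polynomial [qform X (invmx X *m y + t *: x)] in [t] is nonnegative, so its discriminant is
    not positive. *)
Lemma cauchy_schwarz X x y : posdef X ->
  \tr (y^T *m x) ^+ 2 <= qform (invmx X) y * qform X x.
Proof.
move=> pX; apply: discriminant_le; first exact: posdef_qform_ge0.
move=> t; have := posdef_qform_ge0 (invmx X *m y + t *: x) pX.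
suff -> : qform X (invmx X *m y + t *: x) =
  qform (invmx X) y + 2 * \tr (y^T *m x) * t + qform X x * t ^+ 2 by [].
have uX := posdef_unit pX; have sX := posdef_sym pX.
have uT : (invmx X *m y + t *: x)^T = y^T *m invmx X + t *: x^T.
  by rewrite linearD linearZ /= trmx_mul trmx_inv sX.
have yx : \tr (x^T *m y) = \tr (y^T *m x).
  by rewrite -mxtrace_tr trmx_mul trmxK.
rewrite /qform uT !mulmxDl mulmxKV // !mulmxDr -!scalemxAl -!scalemxAr.
rewrite -[x^T *m X *m (invmx X *m y)]mulmxA mulKVmx //.
rewrite !mxtraceD !mxtraceZ yx mulmxA.
ring.
Qed.

Lemma invmx_uniq X Y : X *m Y = 1%:M -> Y = invmx X.
Proof.
by move=> h; have [uX _] := mulmx1_unit h; rewrite -[Y](mulKmx uX) h mulmx1.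
Qed.

(* Sherman-Morrison *)
Lemma invmx_rank1_update X x t : X \in unitmx ->
  1 + t * qform (invmx X) x != 0 ->
  invmx (X + t *: (x *m x^T)) = invmx X -
    (t / (1 + t * qform (invmx X) x)) *: (invmx X *m (x *m x^T) *m invmx X).
Proof.
move=> uX; set b := qform _ _ => dN0; symmetry; apply: invmx_uniq.
have rank1 : x *m x^T *m invmx X *m (x *m x^T) = b *: (x *m x^T).
  transitivity (x *m (x^T *m invmx X *m x) *m x^T); first by rewrite !mulmxA.
  by rewrite [x^T *m _ *m x]mx11_scalar -trace_mx11 mul_mx_scalar -scalemxAl.
set Z := x *m x^T *m invmx X.
have XZ : X *m (invmx X *m (x *m x^T) *m invmx X) = Z.
  by rewrite -!mulmxA mulKVmx // mulmxA.
have zZ : x *m x^T *m (invmx X *m (x *m x^T) *m invmx X) = b *: Z.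
  by rewrite /Z scalemxAl -rank1 !mulmxA.
rewrite mulmxBr !mulmxDl mulmxV // -!scalemxAl -!scalemxAr XZ zZ -/Z.
rewrite !scalerA -addrA -scalerDl -scalerBl.
rewrite (_ : _ - _ = 0) ?scale0r ?addr0 //; field; exact: dN0.
Qed.

Lemma resolvent (S M : 'M[R]_r) d : S \in unitmx -> S + d *: M \in unitmx ->
  invmx S - invmx (S + d *: M) = d *: (invmx S *m M *m invmx (S + d *: M)).
Proof.
move=> uS uB; set B := S + _ in uB *.
have -> : invmx S - invmx B = invmx S *m (B - S) *m invmx B.
  by rewrite mulmxBr mulmxBl mulVmx // mul1mx mulmxK.
have -> : B - S = d *: M by rewrite /B addrC addKr.
by rewrite -scalemxAr -scalemxAl.
Qed.

Lemma resolventC (S M : 'M[R]_r) d : S \in unitmx -> S + d *: M \in unitmx ->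
  invmx S - invmx (S + d *: M) = d *: (invmx (S + d *: M) *m M *m invmx S).
Proof.
move=> uS uB; set B := S + _ in uB *.
have -> : invmx S - invmx B = invmx B *m (B - S) *m invmx S.
  by rewrite mulmxBr mulmxBl mulVmx // mul1mx mulmxK.
have -> : B - S = d *: M by rewrite /B addrC addKr.
by rewrite -scalemxAr -scalemxAl.
Qed.

End PositiveDefinite.

(** Only [t < 0] is delicate: by Cauchy-Schwarz the updated form at [y] is still at least
    [(1 + t * qform (invmx X) x) * qform X y]. *)
Lemma posdef_rank1_update (R : realFieldType) r (X : 'M[R]_r) (x : 'cV_r) t :
  posdef X -> 0 < 1 + t * qform (invmx X) x -> posdef (X + t *: (x *m x^T)).
Proof.
move=> pX pos; have [sX qX] := pX; split.
  by rewrite linearD linearZ /= trmx_mul trmxK sX.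
move=> y yN0; have q0 := qX y yN0; rewrite qformD qformZ qform_rank1.
have cs := cauchy_schwarz y x pX.
have [t0|t0] := lerP 0 t; first by rewrite ltr_pwDl // mulr_ge0 // sqr_ge0.
apply: lt_le_trans (_ : (1 + t * qform (invmx X) x) * qform X y <= _).
  by rewrite mulr_gt0.
by rewrite mulrDl mul1r lerD2l -mulrA ler_wnM2l // ltW.
Qed.

(** * Weighted Gram matrices *)

Section Gram.
Variables (R : realFieldType) (r : nat) (I : finType) (v : I -> 'cV[R]_r).
Implicit Types (w s : I -> R).

Definition gram w : 'M[R]_r := \sum_i w i *: (v i *m (v i)^T).

Lemma gram_sym w : (gram w)^T = gram w.
Proof.
rewrite /gram linear_sum /=; apply: eq_bigr => i _.
by rewrite linearZ /= trmx_mul trmxK.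
Qed.

Lemma trace_gram X w : \tr (X *m gram w) = \sum_i w i * qform X (v i).
Proof.
rewrite /gram mulmx_sumr linear_sum /=; apply: eq_bigr => i _.
by rewrite -scalemxAr mxtraceZ -qformE.
Qed.

Lemma qform_gram w x : qform (gram w) x = \sum_i w i * \tr ((v i)^T *m x) ^+ 2.
Proof.
rewrite qformE mxtrace_mulC trace_gram; apply: eq_bigr => i _.
rewrite qform_rank1; congr (_ * _ ^+ 2).
by rewrite -mxtrace_tr trmx_mul trmxK.
Qed.

Lemma trace_gram_ge0 X w : (forall i, 0 <= w i) ->
  (forall x, 0 <= qform X x) -> 0 <= \tr (X *m gram w).
Proof. by move=> w0 pX; rewrite trace_gram sumr_ge0 // => i _; rewrite mulr_ge0. Qed.

Lemma gramD_rank1 s i t :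
  gram (fun j => s j + (if j == i then t else 0)) =
  gram s + t *: (v i *m (v i)^T).
Proof.
rewrite /gram -[in RHS](big_pred1_eq +%R i (fun j => t *: (v j *m (v j)^T))).
rewrite [in RHS]big_mkcond -big_split /=; apply: eq_bigr => j _.
by rewrite scalerDl; case: eqP; rewrite ?scale0r.
Qed.

End Gram.

(** * The barrier potentials *)

(* [B = S + d M] plays two roles. For the upper barrier, [S = u M - A] is the
   current matrix and [B] the one after [u] grows by [d]; for the lower barrier,
   [B = A - l M] is the current one and [S] the one after [l] grows by [d]. *)
Section Resolvents.
Variables (R : realFieldType) (r : nat) (I : finType) (v : I -> 'cV[R]_r).
Variables (w : I -> R) (w_ge0 : forall i, 0 <= w i).
Let M := gram v w.
Hypothesis (M_posdef : posdef M) (r_gt0 : (0 < r)%N).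
Variables (S : 'M[R]_r) (S_posdef : posdef S) (d : R) (d_gt0 : 0 < d).
Let B := S + d *: M.
Let G := invmx S.
Let H := invmx B.

(** Rate at which the potential [tr (X^-1 M)] decreases from [X = S] to [X = B], see
    [trace_resolventB]. *)
Definition resolvent_gap := \tr (G *m M *m H *m M).

Let a := resolvent_gap.

Lemma posdef_shift : posdef B.
Proof.
apply: posdefD => // [|x]; first by rewrite linearZ /= (posdef_sym M_posdef).
by rewrite qformZ mulr_ge0 ?posdef_qform_ge0 // ltW.
Qed.

Let uS := posdef_unit S_posdef.
Let uB := posdef_unit posdef_shift.
Let pG : posdef G := posdef_inv S_posdef.
Let pH : posdef H := posdef_inv posdef_shift.
Let sG := posdef_sym pG.
Let sH := posdef_sym pH.
Let sM := posdef_sym M_posdef.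

Let gapC : \tr (H *m M *m G *m M) = a.
Proof. by rewrite /a /resolvent_gap -mulmxA mxtrace_mulC !mulmxA. Qed.

Lemma trace_resolventB : \tr (G *m M) - \tr (H *m M) = d * a.
Proof.
by rewrite -linearB /= -mulmxBl [G - H]resolvent // -scalemxAl mxtraceZ.
Qed.

Let trHMH : \tr (H *m M *m H *m M) + d * \tr (H *m M *m G *m M *m H *m M) = a.
Proof.
have -> : a = \tr ((G - H + H) *m M *m H *m M) by rewrite subrK.
rewrite [G - H]resolventC // !mulmxDl.
by rewrite -!scalemxAl mxtraceD mxtraceZ addrC.
Qed.

Let trGMG : \tr (G *m M *m G *m M) = a + d * \tr (G *m M *m H *m M *m G *m M).
Proof.
have -> : \tr (G *m M *m G *m M) = \tr (G *m M *m (G - H + H) *m M).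
  by rewrite subrK.
rewrite [G - H]resolventC // mulmxDr !mulmxDl mxtraceD addrC -scalemxAr -scalemxAl mxtraceZ.
by rewrite !mulmxA.
Qed.

Let qform_sandwich X Y x : X^T = X ->
  qform (X *m M *m Y *m M *m X) x = qform Y (M *m X *m x).
Proof.
move=> sX; have : (M *m X)^T = X *m M by rewrite trmx_mul sM sX.
by move=> e; rewrite /qform [(_ *m x)^T]trmx_mul e !mulmxA.
Qed.

Let trHMH_le : \tr (H *m M *m H *m M) <= a.
Proof.
rewrite -trHMH lerDl mulr_ge0 ?(ltW d_gt0) //; apply: trace_gram_ge0 => // x.
by rewrite qform_sandwich // posdef_qform_ge0.
Qed.

(** If [tr (H M H M)] vanished, so would every weighted term of [M]; then [M = 0], which is not
    positive definite in dimension [r > 0]. *)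
Lemma resolvent_gap_gt0 : 0 < a.
Proof.
apply: lt_le_trans trHMH_le; rewrite trace_gram.
have term i : 0 <= w i * qform (H *m M *m H) (v i).
  by rewrite qform_congr // mulr_ge0 // posdef_qform_ge0.
rewrite lt_def sumr_ge0 // andbT; apply/negP => /eqP /psumr_eq0P h.
have {}h i : w i *: (v i *m (v i)^T) = 0.
  have /eqP := h (fun i _ => term i) i isT.
  rewrite mulf_eq0 => /orP[/eqP->|]; first by rewrite scale0r.
  rewrite qform_congr // => /eqP q0.
  have /eqP Hv : H *m v i == 0.
    by apply: contraT => /(proj2 M_posdef); rewrite q0 ltxx.
  have uH : H \in unitmx by rewrite unitmx_inv.
  by rewrite -[v i](mulKmx uH) Hv mulmx0 mul0mx scaler0.
have M0 : M = 0 by rewrite /M /gram big1.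
have xN0 : const_mx 1 != 0 :> 'cV[R]_r.
  apply/eqP => /matrixP /(_ (Ordinal r_gt0) 0); rewrite !mxE => /eqP.
  by rewrite oner_eq0.
by have := proj2 M_posdef _ xN0; rewrite M0 /qform mulmx0 mul0mx mxtrace0 ltxx.
Qed.

(** Cauchy-Schwarz for the form [tr (Y^T H Z M)] in [Y] and [Z], applied to the identity and
    [M G]. *)
Let gap_cauchy_schwarz :
  a ^+ 2 <= \tr (H *m M) * \tr (G *m M *m H *m M *m G *m M).
Proof.
apply: discriminant_le.
  by apply: trace_gram_ge0 => // x; rewrite qform_sandwich // posdef_qform_ge0.
move=> t; pose Y := 1%:M + t *: (M *m G).
have YT : Y^T = 1%:M + t *: (G *m M).
  by rewrite /Y linearD linearZ /= trmx1 trmx_mul sM sG.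
have : 0 <= \tr (Y^T *m H *m Y *m M).
  apply: trace_gram_ge0 => // x.
  have -> : qform (Y^T *m H *m Y) x = qform H (Y *m x).
    by rewrite /qform trmx_mul !mulmxA.
  exact: posdef_qform_ge0.
suff -> : \tr (Y^T *m H *m Y *m M) = \tr (H *m M) + 2 * a * t +
  \tr (G *m M *m H *m M *m G *m M) * t ^+ 2 by [].
rewrite YT /Y !mulmxDl !mulmxDr !mul1mx !mulmx1 !mulmxDl.
rewrite -!scalemxAl -!scalemxAr -!scalemxAl !mxtraceD !mxtraceZ !mulmxA.
rewrite gapC -/a; ring.
Qed.

(* Adding [t x x^T] to [A] keeps the upper potential from increasing when
   [upper_score x < 1/t], and the lower one when [1/t <= lower_score x]. *)
Definition upper_score x := qform (H *m M *m H) x / (d * a) + qform H x.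

Definition lower_score x := qform (G *m M *m G) x / (d * a) - qform G x.

Let da_gt0 : 0 < d * a. Proof. by rewrite mulr_gt0 // resolvent_gap_gt0. Qed.

Lemma upper_score_sum_le :
  \sum_i w i * upper_score (v i) <= d^-1 + \tr (G *m M).
Proof.
have -> : \sum_i w i * upper_score (v i) =
    \tr (H *m M *m H *m M) / (d * a) + \tr (H *m M).
  rewrite !trace_gram mulr_suml -big_split /=; apply: eq_bigr => i _.
  by rewrite mulrDr mulrA.
apply: lerD.
  by rewrite ler_pdivrMr // mulrA mulVf ?mul1r ?gt_eqF.
by rewrite -subr_ge0 trace_resolventB ltW.
Qed.

Lemma lower_score_sum_ge : d * \tr (H *m M) <= 1 ->
  d^-1 - \tr (H *m M) <= \sum_i w i * lower_score (v i).
Proof.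
move=> small.
have -> : \sum_i w i * lower_score (v i) =
    \tr (G *m M *m G *m M) / (d * a) - \tr (G *m M).
  rewrite !trace_gram mulr_suml -sumrB /=; apply: eq_bigr => i _.
  by rewrite mulrBr mulrA.
have -> : \tr (G *m M) = \tr (H *m M) + d * a by rewrite -trace_resolventB; ring.
(* By [trGMG] this reduces to [d a^2 <= tr (G M H M G M)], which is [gap_cauchy_schwarz] combined
   with [d tr (H M) <= 1]. *)
suff : d^-1 + d * a <= \tr (G *m M *m G *m M) / (d * a) by lra.
rewrite ler_pdivlMr // trGMG.
have -> : (d^-1 + d * a) * (d * a) = a + d * (d * a ^+ 2).
  by field; rewrite gt_eqF.
rewrite lerD2l ler_pM2l //.
apply: le_trans (_ : d * (\tr (H *m M) * \tr (G *m M *m H *m M *m G *m M)) <= _).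
  by rewrite ler_pM2l // gap_cauchy_schwarz.
rewrite mulrA -[leRHS]mul1r ler_wpM2r //.
by apply: trace_gram_ge0 => // x; rewrite qform_sandwich // posdef_qform_ge0.
Qed.

Let trace_rank1_update X x t : posdef X -> 0 < 1 + t * qform (invmx X) x ->
  \tr (invmx (X + t *: (x *m x^T)) *m M) = \tr (invmx X *m M) -
    t * qform (invmx X *m M *m invmx X) x / (1 + t * qform (invmx X) x).
Proof.
move=> pX pos; rewrite invmx_rank1_update ?posdef_unit ?gt_eqF //.
rewrite mulmxBl linearB /= -scalemxAl mxtraceZ mulrAC; congr (_ - _ * _ / _).
by rewrite qformE mxtrace_mulC !mulmxA mxtrace_mulC !mulmxA.
Qed.

(** Raising the barrier lowers the potential by [d a]; by Sherman-Morrison the rank-one term then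
    raises it by a fraction that the score condition keeps below [d a]. *)
Lemma upper_barrier_step x t : 0 < t -> t * upper_score x < 1 ->
  posdef (B - t *: (x *m x^T)) /\
  \tr (invmx (B - t *: (x *m x^T)) *m M) <= \tr (G *m M).
Proof.
move=> t0 tU; rewrite -scaleNr.
have g0 : 0 <= qform (H *m M *m H) x.
  by rewrite qform_congr // posdef_qform_ge0.
have pos : 0 < 1 + - t * qform H x.
  rewrite mulNr subr_gt0; apply: le_lt_trans tU; rewrite ler_pM2l //.
  by rewrite lerDr divr_ge0 // ltW.
split; first exact: posdef_rank1_update posdef_shift pos.
rewrite (trace_rank1_update posdef_shift pos).
suff : t * qform (H *m M *m H) x / (1 + - t * qform H x) <= d * a.
  by rewrite -trace_resolventB !mulNr -/H; lra.
rewrite ler_pdivrMr //.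
have e : t * qform (H *m M *m H) x =
    t * (upper_score x - qform H x) * (d * a).
  by rewrite /upper_score addrK -mulrA mulfVK ?gt_eqF.
rewrite e mulrC ler_pM2l //; lra.
Qed.

Lemma lower_barrier_step x t : 0 < t -> 1 <= t * lower_score x ->
  posdef (S + t *: (x *m x^T)) /\
  \tr (invmx (S + t *: (x *m x^T)) *m M) <= \tr (H *m M).
Proof.
move=> t0 tL.
have pos : 0 < 1 + t * qform G x.
  by rewrite ltr_pwDl // mulr_ge0 ?posdef_qform_ge0 // ltW.
split; first exact: posdef_rank1_update pos.
rewrite (trace_rank1_update S_posdef pos).
suff : d * a <= t * qform (G *m M *m G) x / (1 + t * qform G x).
  by rewrite -trace_resolventB -/G; lra.
rewrite ler_pdivlMr //.
have e : t * qform (G *m M *m G) x =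
    t * (lower_score x + qform G x) * (d * a).
  by rewrite /lower_score subrK -mulrA mulfVK ?gt_eqF.
rewrite e mulrC ler_pM2r //; lra.
Qed.

End Resolvents.

(** * The barrier iteration *)

Definition wsupport (R : realFieldType) (I : finType) (s : I -> R) : {set I} :=
  [set i | s i != 0].

Lemma wsupport0 (R : realFieldType) (I : finType) :
  wsupport (fun _ : I => 0 : R) = set0.
Proof. by apply/setP => i; rewrite !inE eqxx. Qed.

Section BarrierMethod.
Variables (R : realFieldType) (r : nat) (I : finType) (v : I -> 'cV[R]_r).
Variables (w : I -> R) (w_ge0 : forall i, 0 <= w i).
Let M := gram v w.
Hypothesis (M_posdef : posdef M) (r_gt0 : (0 < r)%N).

(** Cauchy-Schwarz summed over the [v i] gives [qform M x <= tr (Y^-1 M) * qform Y x]: a small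
    potential leaves room to move the lower barrier. *)
Lemma posdef_subr_gram (Y : 'M[R]_r) d : 0 < d -> posdef Y ->
  d * \tr (invmx Y *m M) < 1 -> posdef (Y - d *: M).
Proof.
move=> d0 pY small; have [sY qY] := pY; split.
  by rewrite linearB linearZ /= sY (posdef_sym M_posdef).
move=> x xN0; rewrite qformB qformZ subr_gt0.
apply: le_lt_trans (_ : d * \tr (invmx Y *m M) * qform Y x < _); last first.
  by rewrite gtr_pMl // qY.
rewrite -mulrA ler_pM2l // qform_gram trace_gram mulr_suml ler_sum // => i _.
by rewrite -mulrA ler_wpM2l // cauchy_schwarz.
Qed.

Lemma barrier_step (X Y : 'M[R]_r) (dU dL phi : R) :
  posdef X -> \tr (invmx X *m M) <= phi ->
  posdef Y -> \tr (invmx Y *m M) <= phi ->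
  0 < dU -> 0 < dL -> dL * phi < 1 -> dU^-1 + phi < dL^-1 - phi ->
  exists (i : I) (t : R), [/\ w i != 0, 0 < t,
    posdef (X + dU *: M - t *: (v i *m (v i)^T)) /\
    \tr (invmx (X + dU *: M - t *: (v i *m (v i)^T)) *m M) <= phi &
    posdef (Y - dL *: M + t *: (v i *m (v i)^T)) /\
    \tr (invmx (Y - dL *: M + t *: (v i *m (v i)^T)) *m M) <= phi].
Proof.
move=> pX tX pY tY dU0 dL0 small gap.
have small' : dL * \tr (invmx Y *m M) < 1.
  by apply: le_lt_trans small; rewrite ler_pM2l.
pose S := Y - dL *: M.
have pS : posdef S by exact: posdef_subr_gram.
have SY : S + dL *: M = Y by rewrite subrK.
pose U i := upper_score v w X dU (v i).
pose L i := lower_score v w S dL (v i).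
(* Averaging: by the hypothesis on [dU] and [dL] the lower scores have the larger weighted sum, so
   some index has lower score above upper score. *)
have /existsP[i Hi] : [exists i, w i * U i < w i * L i].
  apply: contraT; rewrite negb_exists => /forallP no.
  have : \sum_i w i * L i <= \sum_i w i * U i.
    by apply: ler_sum => i _; rewrite leNgt.
  have := upper_score_sum_le w_ge0 M_posdef r_gt0 pX dU0.
  have := lower_score_sum_ge w_ge0 M_posdef r_gt0 pS dL0.
  rewrite -/M SY => /(_ (ltW small')) lo up le.
  have : dL^-1 - \tr (invmx Y *m M) <= dU^-1 + \tr (invmx X *m M).
    exact: le_trans lo (le_trans le up).
  lra.
have wi0 : w i != 0 by apply: contraTneq Hi => ->; rewrite !mul0r ltxx.
have wp : 0 < w i by rewrite lt_def wi0 w_ge0.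
move: Hi; rewrite ltr_pM2l // => UL.
have U0 : 0 <= U i.
  have pH := posdef_inv (posdef_shift M_posdef pX dU0).
  rewrite addr_ge0 ?posdef_qform_ge0 // divr_ge0 //.
    by rewrite qform_congr ?posdef_qform_ge0 // posdef_sym.
  by rewrite mulr_ge0 ?(ltW dU0) // ltW // resolvent_gap_gt0.
have L0 : 0 < L i by exact: le_lt_trans U0 UL.
(* This [t] meets the lower condition with equality and the upper one strictly. *)
exists i, (L i)^-1; split=> //; first by rewrite invr_gt0.
- have [||pU tU] := upper_barrier_step w_ge0 M_posdef r_gt0 pX dU0 (x := v i)
    (t := (L i)^-1); first by rewrite invr_gt0.
    by rewrite mulrC ltr_pdivrMr // mul1r.
  by split=> //; exact: le_trans tU tX.
- have [||pL tL] := lower_barrier_step w_ge0 M_posdef r_gt0 pS dL0 (x := v i)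
    (t := (L i)^-1); first by rewrite invr_gt0.
    by rewrite mulVf ?gt_eqF.
  by split=> //; apply: le_trans tL _; rewrite -/M SY.
Qed.

Lemma trace_scaled_inv (c : R) : c != 0 -> \tr (invmx (c *: M) *m M) = r%:R / c.
Proof.
move=> c0; have uM := posdef_unit M_posdef.
have ucM : c *: M \in unitmx.
  by rewrite -mul_scalar_mx unitmx_mul uM unitmxE det_scalar unitrX // unitfE.
by rewrite invmxZ // -scalemxAl mulVmx // mxtraceZ mxtrace1 mulrC.
Qed.

(** Each step moves the lower barrier by 1 and the upper one by [d]. They start at [- r / phi] and
    [r / phi], where both potentials equal [phi]. *)
Lemma barrier_iteration (d phi : R) (k : nat) :
  0 < d -> 0 < phi -> phi < 1 -> d^-1 + phi < 1 - phi ->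
  exists s : I -> R, [/\ forall i, 0 <= s i,
    forall i, s i != 0 -> w i != 0,
    (#|wsupport s| <= k)%N,
    posdef ((r%:R / phi + k%:R * d) *: M - gram v s) /\
    \tr (invmx ((r%:R / phi + k%:R * d) *: M - gram v s) *m M) <= phi &
    posdef (gram v s - (k%:R - r%:R / phi) *: M) /\
    \tr (invmx (gram v s - (k%:R - r%:R / phi) *: M) *m M) <= phi].
Proof.
move=> d0 phi0 phi1 gap; elim: k => [|k [s [s0 sw card [pX tX] [pY tY]]]].
  have g0 : gram v (fun=> 0) = 0 :> 'M[R]_r.
    by rewrite /gram big1 // => i _; rewrite scale0r.
  have rphi : 0 < r%:R / phi :> R by rewrite divr_gt0 // ltr0n.
  exists (fun=> 0); rewrite g0 mul0r addr0 subr0 !sub0r scaleNr opprK.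
  have tr : \tr (invmx (r%:R / phi *: M) *m M) <= phi.
    rewrite trace_scaled_inv ?gt_eqF // invf_div mulrCA mulfV ?mulr1 //.
    by rewrite pnatr_eq0 -lt0n.
  have pd : posdef (r%:R / phi *: M) by exact: posdefZ.
  split=> // [i|]; first by rewrite eqxx.
  by rewrite wsupport0 cards0.
have [||i [t [wi t0 [pX' tX'] [pY' tY']]]] := barrier_step pX tX pY tY d0 ltr01.
  by rewrite mul1r.
  by rewrite invr1.
exists (fun j => s j + (if j == i then t else 0)); rewrite gramD_rank1.
have eX : (r%:R / phi + k.+1%:R * d) *: M - (gram v s + t *: (v i *m (v i)^T)) =
  (r%:R / phi + k%:R * d) *: M - gram v s + d *: M - t *: (v i *m (v i)^T).
  have -> : r%:R / phi + k.+1%:R * d = r%:R / phi + k%:R * d + d.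
    by rewrite -natr1; ring.
  by rewrite (scalerDl M (_ + _)) opprD addrA (addrAC _ (d *: M)).
have eY : gram v s + t *: (v i *m (v i)^T) - (k.+1%:R - r%:R / phi) *: M =
  gram v s - (k%:R - r%:R / phi) *: M - 1 *: M + t *: (v i *m (v i)^T).
  have -> : k.+1%:R - r%:R / phi = k%:R - r%:R / phi + 1.
    by rewrite -natr1; ring.
  by rewrite scalerDl opprD addrA 2!(addrAC _ (t *: _)).
rewrite eX eY; split=> // [j|j|].
- by rewrite addr_ge0 //; case: eqP => // _; exact: ltW.
- by have [->//|_] := eqVneq j i; rewrite addr0; exact: sw.
- apply: leq_trans (_ : (#|i |: wsupport s| <= _)%N).
    apply/subset_leq_card/subsetP => j; rewrite !inE.
    by case: (j =P i) => //= _; rewrite addr0.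
  by rewrite cardsU1 -add1n leq_add // leq_b1.
Qed.

End BarrierMethod.

(** * Sparsification of sums of squares *)

Lemma posdef_sparsifier (R : archiRealFieldType) r (I : finType)
    (v : I -> 'cV[R]_r) (w : I -> R) (eps : R) :
  (forall i, 0 <= w i) -> posdef (gram v w) -> 0 < eps -> eps < 1 ->
  exists s : I -> R, [/\ forall i, 0 <= s i,
    forall i, s i != 0 -> w i != 0,
    #|wsupport s|%:R <= 50 * r%:R / eps ^+ 2 &
    forall x, (1 - eps) * qform (gram v w) x <= qform (gram v s) x /\
              qform (gram v s) x <= (1 + eps) * qform (gram v w) x].
Proof.
move=> w0 pM e0 e1; case: (posnP r) => [r_eq0|r0].
  subst r; exists (fun=> 0); split=> // [i||x].
  - by rewrite eqxx.
  - by rewrite wsupport0 cards0 mulr0 mul0r.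
  - by rewrite [x]flatmx0 !qform0 !mulr0.
(* [r N] steps with [N] about [phi^-2]: the initial offsets [r / phi] of the
   barriers become a relative error [phi], and the growth rate [d] of the upper
   one is at most [1 + 6 phi]. *)
pose phi := eps / 7; pose d := (1 - 3 * phi)^-1.
have phi0 : 0 < phi by rewrite divr_gt0.
have phi7 : phi < 7^-1 by rewrite /phi; lra.
have eps_phi : eps = 7 * phi by rewrite /phi; field.
have den0 : 0 < 1 - 3 * phi by lra.
have d0 : 0 < d by rewrite invr_gt0.
have phi2 : 0 <= phi ^- 2 by rewrite invr_ge0 sqr_ge0.
pose N := (Num.truncn (phi ^- 2)).+1.
have /andP[Nlo Nhi] := truncn_itv phi2.
have N0 : 0 < N%:R :> R by rewrite ltr0n.
have NphiV : 1 <= phi ^+ 2 * N%:R.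
  by rewrite -ler_pdivrMl ?exprn_gt0 // mulr1 ltW.
have rR : 0 < r%:R :> R by rewrite ltr0n.
have T0 : 0 < (r * N)%:R :> R by rewrite natrM mulr_gt0.
have [||s [s0 sw card [[_ pX] _] [[_ pY] _]]] :=
  barrier_iteration w0 pM r0 (r * N) d0 phi0.
  by lra.
  (* The choice of [d] turns the gap condition into [1 - 2 phi < 1 - phi]. *)
  by rewrite /d invrK; lra.
exists (fun i => s i / (r * N)%:R); split=> [i|i||x].
- by rewrite divr_ge0 // ltW.
- by rewrite mulf_eq0 negb_or => /andP[/sw].
- rewrite (_ : wsupport _ = wsupport s); last first.
    by apply/setP => i; rewrite !inE mulf_eq0 invr_eq0 (gt_eqF T0) orbF.
  apply: le_trans (_ : (r * N)%:R <= _); first by rewrite ler_nat.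
  rewrite natrM.
  (* The constant 50 is 49 from [phi ^- 2 = 49 eps ^- 2] plus 1 from rounding up, absorbed since
     [1 <= eps ^- 2]. *)
  have e2 : 1 <= eps ^- 2.
    by rewrite invf_ge1 ?exprn_gt0 // exprn_ile1 // ltW.
  have -> : 50 * r%:R / eps ^+ 2 = r%:R * (50 * eps ^- 2) by ring.
  rewrite ler_pM2l //.
  have -> : N%:R = (Num.truncn (phi ^- 2))%:R + 1 :> R by rewrite natr1.
  have : phi ^- 2 = 49 * eps ^- 2.
    by rewrite /phi; field; rewrite gt_eqF.
  lra.
have gs : qform (gram v (fun i => s i / (r * N)%:R)) x =
    qform (gram v s) x / (r * N)%:R.
  rewrite !qform_gram mulr_suml; apply: eq_bigr => i _.
  by rewrite mulrAC.
rewrite gs ler_pdivlMr // ler_pdivrMr //.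
have [->|xN0] := eqVneq x 0; first by rewrite !qform0 !mulr0 !mul0r.
have q0 := posdef_qform_ge0 x pM.
have {pX} := pX x xN0; have {pY} := pY x xN0.
rewrite !qformB !qformZ !subr_gt0 => lo hi; split.
- apply: le_trans _ (ltW lo); rewrite mulrAC ler_wpM2r //.
  rewrite natrM eps_phi.
  have : r%:R / phi <= phi * (r%:R * N%:R).
    rewrite ler_pdivrMr // (_ : _ * phi = r%:R * (phi ^+ 2 * N%:R)); last by ring.
    by rewrite ler_pMr.
  have : 0 <= phi * (r%:R * N%:R) by rewrite ltW // mulr_gt0 // mulr_gt0.
  lra.
- apply: le_trans (ltW hi) _; rewrite [leRHS]mulrAC ler_wpM2r //.
  rewrite natrM eps_phi.
  have h1 : r%:R / phi <= phi * (r%:R * N%:R).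
    rewrite ler_pdivrMr // (_ : _ * phi = r%:R * (phi ^+ 2 * N%:R)); last by ring.
    by rewrite ler_pMr.
  (* This holds because [phi <= 1/6]. Adding the offset error [phi] gives [1 + 7 phi = 1 + eps]. *)
  have h2 : d <= 1 + 6 * phi.
    rewrite /d -[_^-1]mul1r ler_pdivrMr //; nra.
  have : r%:R * N%:R * d <= r%:R * N%:R * (1 + 6 * phi).
    by rewrite ler_pM2l // -natrM.
  lra.
Qed.

(* The Gram matrix of the [a i] may be singular: factor the matrix with rows
   [a i] through its rank. Rows of weight 0 are cleared, since they could raise
   the rank without contributing to the Gram matrix. *)
Lemma square_sum_sparsifier (R : archiRealFieldType) m (I : finType)
    (a : I -> 'rV[R]_m) (w : I -> R) (eps : R) :
  (forall i, 0 <= w i) -> 0 < eps -> eps < 1 ->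
  exists s : I -> R, [/\ forall i, 0 <= s i,
    forall i, s i != 0 -> w i != 0,
    #|wsupport s|%:R <= 50 * m%:R / eps ^+ 2 &
    forall x : 'cV_m,
      (1 - eps) * (\sum_i w i * \tr (a i *m x) ^+ 2)
        <= \sum_i s i * \tr (a i *m x) ^+ 2 /\
      \sum_i s i * \tr (a i *m x) ^+ 2
        <= (1 + eps) * (\sum_i w i * \tr (a i *m x) ^+ 2)].
Proof.
move=> w0 e0 e1.
pose V : 'M[R]_(#|I|, m) :=
  \matrix_k (if w (enum_val k) == 0 then 0 else a (enum_val k)).
pose L := col_base V; pose F := row_base V.
pose v i : 'cV[R]_(\rank V) := (row (enum_rank i) L)^T.
have vF i : (v i)^T *m F = if w i == 0 then 0 else a i.
  by rewrite /v trmxK -row_mul mulmx_base rowK enum_rankK.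
have vF_gram t x : (forall i, t i != 0 -> w i != 0) ->
    qform (gram v t) (F *m x) = \sum_i t i * \tr (a i *m x) ^+ 2.
  move=> tw; rewrite qform_gram; apply: eq_bigr => i _; rewrite mulmxA vF.
  have [->|/tw/negPf->//] := eqVneq (t i) 0; by rewrite !mul0r.
have pM : posdef (gram v w).
  split=> [|y yN0]; first exact: gram_sym.
  rewrite qform_gram.
  have term i : 0 <= w i * \tr ((v i)^T *m y) ^+ 2 by rewrite mulr_ge0 ?sqr_ge0.
  rewrite lt_def sumr_ge0 // andbT; apply: contra yN0 => /eqP /psumr_eq0P h.
  (* [L] has a left inverse, so a vector orthogonal to all its rows is zero. *)
  have /row_fullP[Z ZL] : row_full L by exact: col_base_full.
  suff Ly : L *m y = 0 by rewrite -[y]mul1mx -ZL -mulmxA Ly mulmx0.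
  apply/row_matrixP => k; rewrite row_mul row0 -[k]enum_valK.
  move: (enum_val k) => i; have /eqP := h (fun i _ => term i) i isT.
  rewrite mulf_eq0 expf_eq0 /= => /orP[wi0|].
    (* A cleared row of [V] has zero coordinates in the row basis [F]. *)
    have := vF i; rewrite wi0 => /eqP; rewrite mulmx_free_eq0 ?row_base_free //.
    by rewrite /v trmxK => /eqP->; rewrite mul0mx.
  rewrite /v trmxK trace_mx11 => /eqP h0.
  by rewrite [LHS]mx11_scalar h0 raddf0.
have [s [s0 sw card approx]] := posdef_sparsifier w0 pM e0 e1.
exists s; split=> // [|x].
  apply: le_trans card _; rewrite ler_pM2r ?invr_gt0 ?exprn_gt0 //.
  by rewrite ler_pM2l // ler_nat rank_leq_col.
by have := approx (F *m x); rewrite !vF_gram.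
Qed.

(** For [x != y] exactly two colours, [x] and [y], contribute 1 each; hence the factor 1/2. *)
Lemma neq_sum_indicators (R : realFieldType) (K : finType) (x y : K) :
  (x != y)%:R = 2^-1 * \sum_k ((x == k)%:R - (y == k)%:R) ^+ 2 :> R.
Proof.
have [->|xy] := eqVneq x y.
  by rewrite big1 ?mulr0 // => k _; rewrite subrr expr0n.
have yx : (y == x) = false by rewrite eq_sym; exact: negPf.
rewrite (bigD1 x) //= (bigD1 y) ?yx //= big1 => [|k /andP[kx ky]].
  by rewrite !eqxx (negPf xy) /=; field.
by rewrite !(eq_sym _ k) (negPf kx) (negPf ky) subrr expr0n.
Qed.

(** * Sparsification of constraint satisfaction problems *)

Section CSPLemmas.
Variables (R : realType) (U : finType) (D E : {set U}) (P : U -> U -> bool).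

Lemma has_singleton_restrictionP :
  has_singleton_restriction D E P <->
  exists a a' c c', [/\ [/\ a \in D, a' \in D, c \in E & c' \in E],
    P a c, ~~ P a c', ~~ P a' c & ~~ P a' c'].
Proof.
split=> [[B [C [BD B2 CE C2 /eqP/cards1P[[a c] eqac]]]]|].
  have mem b d : b \in B -> d \in C -> P b d = ((b, d) == (a, c)).
    by move=> bB dC; rewrite -in_set1 -eqac !inE /= bB dC.
  have : (a, c) \in [set (a, c)] by rewrite set11.
  rewrite -eqac !inE /= => /andP[/andP[aB cC] Pac].
  have other (X : {set U}) x : x \in X -> #|X| = 2%N ->
      exists2 x', x' \in X & x' != x.
    move=> xX; rewrite (cardsD1 x) xX => -[/eqP/cards1P[x' e]].
    by exists x'; have := set11 x'; rewrite -e !inE => /andP[].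
  have [a' a'B aa'] := other B a aB B2; have [c' c'C cc'] := other C c cC C2.
  exists a, a', c, c'; rewrite Pac !mem // !xpair_eqE (negPf aa') (negPf cc').
  by rewrite andbF; split=> //; split; rewrite ?(subsetP BD) ?(subsetP CE).
move=> [a [a' [c [c' [[aD a'D cE c'E] Pac Pac' Pa'c Pa'c']]]]].
have aa' : a != a' by apply: contraNneq Pa'c => <-.
have cc' : c != c' by apply: contraNneq Pac' => <-.
exists [set a; a'], [set c; c']; rewrite !cards2 aa' cc'.
split=> //; try by apply/subsetP => u; rewrite !inE => /orP[] /eqP->.
apply/eqP/cards1P; exists (a, c); apply/setP => -[b d]; rewrite !inE /= xpair_eqE.
apply/idP/idP => [|/andP[/eqP-> /eqP->]]; last by rewrite !eqxx.
by case/andP=> /andP[/orP[] /eqP-> /orP[] /eqP->];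
  rewrite ?eqxx ?(negPf Pac') ?(negPf Pa'c) ?(negPf Pa'c').
Qed.

Let zeros a : {set U} := [set c in E | ~~ P a c].

(** Three zeros of a 2 x 2 rectangle force the fourth, so two rows have equal or disjoint zero sets.
    A row is coloured by its zero set, a column by that of some row vanishing on it; [None] marks
    columns without zeros. *)
Lemma disequality_form : ~ has_singleton_restriction D E P ->
  exists f g : U -> option {set U},
    forall a c, a \in D -> c \in E -> P a c = (f a != g c).
Proof.
move=> nosingle.
have rect a a' c c' : a \in D -> a' \in D -> c \in E -> c' \in E ->
    ~~ P a c' -> ~~ P a' c -> ~~ P a' c' -> ~~ P a c.
  move=> aD a'D cE c'E h1 h2 h3; apply/negP => Pac; apply: nosingle.
  by apply/has_singleton_restrictionP; exists a, a', c, c'.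
exists (fun a => Some (zeros a)).
exists (fun c => omap zeros [pick a in D | ~~ P a c]).
move=> a c aD cE; apply/idP/idP => [Pac|].
  case: pickP => [a' /andP[a'D Pa'c]|//] /=.
  apply: contraTneq Pac => -[ez].
  have : c \in zeros a by rewrite ez inE cE Pa'c.
  by rewrite inE cE.
apply: contraR => Pac; case: pickP => [a' /andP[a'D Pa'c]|/(_ a)]; last first.
  by rewrite aD Pac.
apply/eqP; congr Some; apply/setP => c'; rewrite !inE.
case c'E : (c' \in E) => //=; apply/idP/idP => h.
  exact: (rect a' a c' c).
exact: (rect a a' c' c).
Qed.

Lemma singleton_lower_bound m (eps : R) :
  has_singleton_restriction D E P -> eps < 1 ->
  exists Pi : {set 'I_(m + m) * 'I_(m + m)},
    is_instance Pi (fun=> 1 : R) /\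
    forall Pi' w', is_sparsifier eps D E P Pi (fun=> 1) Pi' w' ->
      #|Pi'| = (m * m)%N.
Proof.
move=> /has_singleton_restrictionP[a [a' [c [c' [[aD a'D cE c'E]]]]]].
move=> Pac /negPf Pac' /negPf Pa'c /negPf Pa'c' eps1.
pose edge (ij : 'I_m * 'I_m) := (lshift m ij.1, rshift m ij.2).
pose Pi := [set edge ij | ij in [set: 'I_m * 'I_m]].
have edge_inj : injective edge.
  by move=> [i j] [i' j'] [] /ord_inj-> /addnI/ord_inj->.
exists Pi; split.
  split=> [_ /imsetP[ij _ ->]|_ _]; last exact: ltr01.
  by rewrite /= eq_lrshift.
move=> Pi' w' [sub [w'pos approx]].
suff -> : Pi' = Pi.
  by rewrite card_imset // cardsT card_prod !card_ord.
apply/eqP; rewrite eqEsubset sub /=; apply/subsetP => _ /imsetP[[i j] _ ->].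
apply: contraT => eN.
(* Only the constraint [edge (i, j)] is satisfied by this assignment. *)
pose A (u : 'I_(m + m)) := match split u with
  | inl i' => if i' == i then a else a'
  | inr j' => if j' == j then c else c' end.
have Al k : A (lshift m k) = if k == i then a else a'.
  by rewrite /A -[lshift m k]/(unsplit (inl k)) unsplitK.
have Ar k : A (rshift m k) = if k == j then c else c'.
  by rewrite /A -[rshift m k]/(unsplit (inr k)) unsplitK.
have PA i' j' : P (A (lshift m i')) (A (rshift m j')) = ((i', j') == (i, j)).
  by rewrite Al Ar xpair_eqE; do 2!case: eqP => _ /=.
have valid : valid_assignment D E Pi A.
  by move=> _ /imsetP[[i' j'] _ ->]; rewrite /= Al Ar; split; case: ifP.
have Val1 : 1 <= Val P Pi (fun=> 1 : R) A.
  have sat : P (A (edge (i, j)).1) (A (edge (i, j)).2).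
    by have := PA i j; rewrite eqxx.
  rewrite /Val (bigD1 (edge (i, j))) ?imset_f // sat mulr1 lerDl.
  by rewrite sumr_ge0 // => e _; rewrite mul1r.
have Val0 : Val P Pi' w' A = 0.
  rewrite /Val big1 // => e ePi'.
  have /imsetP[[i' j'] _ e_eq] := subsetP sub e ePi'.
  have := PA i' j'; case: eqP => [ij _|_ unsat].
    by rewrite -ij -e_eq ePi' in eN.
  have -> : P (A e.1) (A e.2) = false by rewrite e_eq.
  by rewrite mulr0.
(* Value 0 against a value of at least 1 violates the lower bound, as [1 - eps > 0]. *)
have [+ _] := approx A valid; rewrite Val0; apply: contraTT => _.
by rewrite -ltNge mulr_gt0 ?subr_gt0 // (lt_le_trans ltr01).
Qed.

(* The coordinates of ['I_n + 'I_n] are the vertices of the bipartite double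
   cover: [u] in first position and [v] in second position become distinct. *)
Definition incidence n (e : 'I_n * 'I_n) : 'rV[R]_(n + n) :=
  row_mx (delta_mx 0 e.1) (- delta_mx 0 e.2).

Definition class_indicator (K : eqType) (f g : U -> K) n (A : 'I_n -> U) k :
    'cV[R]_(n + n) :=
  col_mx (\col_u (f (A u) == k)%:R) (\col_u (g (A u) == k)%:R).

Lemma tr_incidence_indicator (K : eqType) (f g : U -> K) n (A : 'I_n -> U) k e :
  \tr (incidence e *m class_indicator f g A k) =
  (f (A e.1) == k)%:R - (g (A e.2) == k)%:R.
Proof.
rewrite mul_row_col mulNmx -!rowE linearB /= !trace_mx11.
by rewrite !mxE.
Qed.

(** Extending the weights by 0 to all pairs lets the instance and its sparsifier be compared over
    one index type; validity for [Pi] covers both. *)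
Lemma Val_disequality (K : finType) (f g : U -> K) n
    (Pi Pi' : {set 'I_n * 'I_n}) (w s : 'I_n * 'I_n -> R) A :
  (forall a c, a \in D -> c \in E -> P a c = (f a != g c)) ->
  valid_assignment D E Pi A -> Pi' \subset Pi ->
  (forall e, e \in Pi' -> s e = w e) -> (forall e, e \notin Pi' -> s e = 0) ->
  Val P Pi' w A =
  2^-1 * \sum_k \sum_e s e * \tr (incidence e *m class_indicator f g A k) ^+ 2.
Proof.
move=> Pfg valid sub s_in s_out; rewrite exchange_big mulr_sumr /= /Val big_mkcond.
apply: eq_bigr => e _; case: ifPn => [ePi'|/s_out s0]; last first.
  by rewrite big1 ?mulr0 // => k _; rewrite s0 mul0r.
have [AD AE] := valid e (subsetP sub e ePi').
rewrite -mulr_sumr s_in // mulrCA; congr (_ * _).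
rewrite Pfg // neq_sum_indicators; congr (_ * _); apply: eq_bigr => k _.
by rewrite tr_incidence_indicator.
Qed.

(** The quadratic form is approximated at all vectors, hence at every colour indicator at once, so
    the bound does not depend on [K]. *)
Lemma disequality_sparsifier (K : finType) (f g : U -> K) (eps : R) n
    (Pi : {set 'I_n * 'I_n}) (w : 'I_n * 'I_n -> R) :
  (forall a c, a \in D -> c \in E -> P a c = (f a != g c)) ->
  0 < eps -> eps < 1 -> weights_pos Pi w ->
  exists Pi' w', is_sparsifier eps D E P Pi w Pi' w' /\
    #|Pi'|%:R <= 100 * n%:R / eps ^+ 2.
Proof.
move=> Pfg e0 e1 wpos.
pose w0 e := if e \in Pi then w e else 0.
have w0_ge0 e : 0 <= w0 e by rewrite /w0; case: ifP => // /wpos/ltW.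
have [s [s0 sw card approx]] :=
  square_sum_sparsifier (@incidence n) w0_ge0 e0 e1.
have sub : wsupport s \subset Pi.
  apply/subsetP => e; rewrite inE => /sw; rewrite /w0.
  by case: ifP => //; rewrite eqxx.
exists (wsupport s), s; split; last first.
  (* The double cover has dimension [n + n], which doubles 50 to 100. *)
  apply: le_trans card _; rewrite natrD (_ : 100 = 50 * 2) //; last by ring.
  by rewrite le_eqVlt (_ : 50 * (n%:R + n%:R) = 50 * 2 * n%:R) ?eqxx //; ring.
split=> //; split=> [e|A valid]; first by rewrite inE lt_def s0 andbT.
rewrite (@Val_disequality K f g n Pi Pi w w0) //; first last.
- by move=> e /negPf eN; rewrite /w0 eN.
- by move=> e eIn; rewrite /w0 eIn.
rewrite (@Val_disequality K f g n Pi (wsupport s) s s) //; last first.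
  by move=> e; rewrite inE negbK => /eqP.
rewrite !(mulrCA _ 2^-1) !mulr_sumr; split.
  rewrite -!mulr_sumr ler_pM2l ?invr_gt0 // mulr_sumr ler_sum // => k _.
  by case: (approx (class_indicator f g A k)).
rewrite -!mulr_sumr ler_pM2l ?invr_gt0 // mulr_sumr ler_sum // => k _.
by case: (approx (class_indicator f g A k)).
Qed.

End CSPLemmas.

Theorem theorem10 (R : realType) (U : finType) (D E : {set U})
  (P : U -> U -> bool) :
  (2 <= #|D|)%N -> (2 <= #|E|)%N ->
  (has_singleton_restriction D E P ->
     forall eps : R, 0 < eps -> eps < 1 ->
     exists c : R, 0 < c /\
       forall N : nat, exists n : nat, (N <= n)%N /\
         exists (Pi : {set 'I_n * 'I_n}) (w : 'I_n * 'I_n -> R),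
           is_instance Pi w /\
           forall (Pi' : {set 'I_n * 'I_n}) (w' : 'I_n * 'I_n -> R),
             is_sparsifier eps D E P Pi w Pi' w' ->
             c * (n%:R) ^+ 2 <= (#|Pi'|)%:R)
  /\
  (~ has_singleton_restriction D E P ->
     exists K : R, 0 < K /\
       forall eps : R, 0 < eps -> eps < 1 ->
       forall (n : nat) (Pi : {set 'I_n * 'I_n}) (w : 'I_n * 'I_n -> R),
         is_instance Pi w ->
         exists (Pi' : {set 'I_n * 'I_n}) (w' : 'I_n * 'I_n -> R),
           is_sparsifier eps D E P Pi w Pi' w' /\
           (#|Pi'|)%:R <= K * n%:R / eps ^+ 2).
Proof.
move=> _ _; split=> [single eps _ eps1|nosingle].
  (* With [n = 2 N] variables, the [N^2] constraints number [n^2 / 4]. *)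
  exists 4^-1; split=> [|N]; first by rewrite invr_gt0.
  exists (N + N)%N; split; first exact: leq_addr.
  have [Pi [inst lower]] := singleton_lower_bound N single eps1.
  exists Pi, (fun=> 1); split=> // Pi' w' /lower ->.
  by rewrite natrD natrM le_eqVlt (_ : _ * _ = N%:R * N%:R) ?eqxx //; field.
have [f [g Pfg]] := disequality_form nosingle.
exists 100; split=> // eps e0 e1 n Pi w [_ wpos].
exact: disequality_sparsifier Pfg e0 e1 wpos.
Qed.
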